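(* Let $\beta\in(1,3/2]$ and let $T_\beta$ and $L_\beta$ be the greedy and lazy maps on $S_\beta$ defined in the context. Then $T_\beta$ admits an invariant probability measure absolutely continuous with respect to Lebesgue measure on $S_\beta$, and so does $L_\beta$.
   Context: Let $\vec q_0=(0,0)$, $\vec q_1=(1,0)$, $\vec q_2=(0,1)$, $f_{\vec q_i}(\vec z)=(\vec z+\vec q_i)/\beta$. $S_\beta$ is the attractor of this IFS; for $1<\beta\le3/2$ it is the closed triangle with vertices $(0,0)$, $(\frac1{\beta-1},0)$, $(0,\frac1{\beta-1})$. Subsets of $S_\beta$: $E_0=[0,\frac1\beta)\times[0,\frac1\beta)$; $E_1=\{0\le y<\frac1\beta,\ \frac{1}{\beta(\beta-1)}<x+y\le\frac{1}{\beta-1}\}$; $E_2=\{0\le x<\frac1\beta,\ \frac{1}{\beta(\beta-1)}<x+y\le\frac{1}{\beta-1}\}$; $C_{01}=\{x\ge\frac1\beta,\ 0\le y<\frac1\beta,\ x+y\le\frac{1}{\beta(\beta-1)}\}$; $C_{12}=\{x\ge\frac1\beta,\ y\ge\frac1\beta,\ \frac{1}{\beta(\beta-1)}<x+y\le\frac{1}{\beta-1}\}$; $C_{02}=\{0\le x<\frac1\beta,\ y\ge\frac1\beta,\ x+y\le\frac{1}{\beta(\beta-1)}\}$; $C_{012}=\{x\ge\frac1\beta,\ y\ge\frac1\beta,\ x+y\le\frac{1}{\beta(\beta-1)}\}$. Greedy map: $T_\beta(\vec z)=\beta\vec z$ on $E_0$, $\beta\vec z-\vec q_1$ on $C_{01}\cup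 E_1$, $\beta\vec z-\vec q_2$ on $C_{012}\cup C_{12}\cup C_{02}\cup E_2$. Lazy map: $L_\beta(\vec z)=\beta\vec z$ on $C_{012}\cup C_{01}\cup C_{02}\cup E_0$, $\beta\vec z-\vec q_1$ on $C_{12}\cup E_1$, $\beta\vec z-\vec q_2$ on $E_2$. *)

(* Defs.v *)
From mathcomp Require Import all_boot all_order all_algebra.
From mathcomp Require Import all_classical all_reals all_analysis.
Set Implicit Arguments. Unset Strict Implicit. Unset Printing Implicit Defensive.
Import Order.TTheory GRing.Theory Num.Theory.
Local Open Scope ring_scope.
Local Open Scope classical_set_scope.

Section Beta.
Variable (R : realType) (b : R).
Implicit Types z : R * R.

Definition thr1 : R := 1 / (b * (b - 1)).
Definition thr2 : R := 1 / (b - 1).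

(* S_beta, the closed triangle (valid description for 1 < b <= 3/2) *)
Definition Sb : set (R * R) :=
  [set z | (0 <= z.1) && (0 <= z.2) && (z.1 + z.2 <= thr2)].

Definition inE0 z : bool :=
  [&& 0 <= z.1, z.1 < 1 / b, 0 <= z.2 & z.2 < 1 / b].
Definition inE1 z : bool :=
  [&& 0 <= z.2, z.2 < 1 / b, thr1 < z.1 + z.2 & z.1 + z.2 <= thr2].
Definition inE2 z : bool :=
  [&& 0 <= z.1, z.1 < 1 / b, thr1 < z.1 + z.2 & z.1 + z.2 <= thr2].
Definition inC01 z : bool :=
  [&& 1 / b <= z.1, 0 <= z.2, z.2 < 1 / b & z.1 + z.2 <= thr1].
Definition inC12 z : bool :=
  [&& 1 / b <= z.1, 1 / b <= z.2, thr1 < z.1 + z.2 & z.1 + z.2 <= thr2].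
Definition inC02 z : bool :=
  [&& 0 <= z.1, z.1 < 1 / b, 1 / b <= z.2 & z.1 + z.2 <= thr1].
Definition inC012 z : bool :=
  [&& 1 / b <= z.1, 1 / b <= z.2 & z.1 + z.2 <= thr1].

(* f_{q_i}^{-1}: z |-> b z - q_i, with q_0 = (0,0), q_1 = (1,0), q_2 = (0,1) *)
Definition shift0 z : R * R := (b * z.1, b * z.2).
Definition shift1 z : R * R := (b * z.1 - 1, b * z.2).
Definition shift2 z : R * R := (b * z.1, b * z.2 - 1).

(* Greedy map; outside S_beta it is (arbitrarily) the identity. *)
Definition greedy z : R * R :=
  if inE0 z then shift0 z
  else if inC01 z || inE1 z then shift1 z
  else if [|| inC012 z, inC12 z, inC02 z | inE2 z] then shift2 z
  else z.

(* Lazy map; outside S_beta it is (arbitrarily) the identity. *)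
Definition lazy z : R * R :=
  if [|| inC012 z, inC01 z, inC02 z | inE0 z] then shift0 z
  else if inC12 z || inE1 z then shift1 z
  else if inE2 z then shift2 z
  else z.

End Beta.

Definition leb2 (R : realType) :=
  ((@lebesgue_measure R) \x (@lebesgue_measure R))%E.

Definition acip (R : realType) (S : set (R * R)) (f : R * R -> R * R)
  (mu : probability (R * R)%type R) : Prop :=
  [/\ mu S = 1%E,
      (forall A : set (R * R), measurable A -> mu (f @^-1` A) = mu A)
    & mu `<< @leb2 R].

(* Main.v *)
Require Import Defs.
From HB Require Import structures.
From mathcomp Require Import all_boot all_order all_algebra.
From mathcomp Require Import all_classical all_reals all_analysis.
From mathcomp Require Import measurable_realfun ring lra.
Import Order.TTheory GRing.Theory Num.Theory.
Import numFieldNormedType.Exports.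
Local Open Scope ring_scope.
Local Open Scope classical_set_scope.
Set Implicit Arguments.
Unset Strict Implicit.
Unset Printing Implicit Defensive.

(* Both maps send z to b z - q, where q depends only on the position of z relative
   to three lines x = c1, y = c2, x + y = c3. Let nu_n be the image under the n-th
   iterate of Lebesgue measure on the unit square, and measure its variation in a
   coordinate direction e by the best V with
     nu_n (A - t e) - nu_n A <= V t   for all t >= 0 and measurable A.
   The cuts of every iterate are still lines of the same three directions, and
   parallel cuts stay a fixed distance apart, so a Lasota-Yorke inequality holds
   whose leading coefficient is 7 / b ^ n for the n-th iterate; for n large it is
   below 1 and V stays bounded. Averaging over small translations then gives
   nu_n A <= 2 V t + Leb A / t ^ 2, so the nu_n are uniformly absolutely continuous,
   and the limit of their Cesaro means along an ultrafilter is a countably additive,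
   invariant, absolutely continuous probability. *)

(** * Finitely additive probabilities and their variation under translations *)

Section Content.
Context {R : realType}.
Local Notation plane := (R * R)%type.
Implicit Types (z e l q : plane) (A B : set plane) (nu : set plane -> R).

(** Finite additivity survives limits along an ultrafilter; countable additivity is recovered at the
    end from uniform absolute continuity. *)
Definition prob_content nu :=
  [/\ forall A, measurable A -> 0 <= nu A, nu setT = 1 &
      forall A B, measurable A -> measurable B -> A `&` B = set0 ->
        nu (A `|` B) = nu A + nu B].

Lemma prob_contentD nu A B : prob_content nu -> measurable A -> measurable B ->
  A `<=` B -> nu B = nu A + nu (B `\` A).
Proof.
case=> _ _ nuU mA mB AB; rewrite -nuU ?setDIK//; last exact: measurableD.
by rewrite setDUK.
Qed.

Lemma prob_content_le nu A B : prob_content nu -> measurable A ->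
  measurable B -> A `<=` B -> nu A <= nu B.
Proof.
move=> cnu mA mB AB; rewrite (prob_contentD cnu mA mB AB) lerDl.
by case: cnu => nu0 _ _; apply: nu0; exact: measurableD.
Qed.

Lemma prob_content_le1 nu A : prob_content nu -> measurable A -> nu A <= 1.
Proof. by move=> cnu mA; have [_ <- _] := cnu; exact: prob_content_le. Qed.

Lemma prob_content_leU nu A B : prob_content nu -> measurable A ->
  measurable B -> nu (A `|` B) <= nu A + nu B.
Proof.
move=> cnu mA mB; have [_ _ nuU] := cnu.
have -> : A `|` B = A `|` (B `\` A) by rewrite setUDr setDv setD0.
rewrite nuU ?setDIK//; last exact: measurableD.
rewrite lerD2l; apply: prob_content_le => //; exact: measurableD.
Qed.

Lemma prob_contentC nu A : prob_content nu -> measurable A ->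
  nu (~` A) = 1 - nu A.
Proof.
move=> cnu mA; have [_ <- _] := cnu.
by rewrite (prob_contentD cnu mA measurableT)// setTD addrAC subrr add0r.
Qed.

Lemma prob_content_preimage nu (f : plane -> plane) : measurable_fun setT f ->
  prob_content nu -> prob_content (fun A => nu (f @^-1` A)).
Proof.
move=> mf [nu0 nu1 nuU].
have mfi A : measurable A -> measurable (f @^-1` A).
  by move=> mA; rewrite -[X in measurable X]setTI; exact: mf.
split=> [A mA||A B mA mB AB].
- by apply: nu0; exact: mfi.
- by rewrite preimage_setT.
- rewrite preimage_setU nuU//; [exact: mfi|exact: mfi|].
  by rewrite -preimage_setI AB preimage_set0.
Qed.

Definition lin l z : R := l.1 * z.1 + l.2 * z.2.

Definition translate e (s : R) z : plane := (z.1 + s * e.1, z.2 + s * e.2).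

Lemma lin_translate l e s z : lin l (translate e s z) = lin l z + s * lin l e.
Proof. rewrite /lin /translate/=; ring. Qed.

Lemma measurable_lin l : measurable_fun setT (lin l).
Proof.
by apply: measurable_funD; apply: measurable_funM.
Qed.

Lemma measurable_translate e s : measurable_fun setT (translate e s).
Proof.
apply/measurable_fun_pairP; split => /=; rewrite /comp/=.
  exact: measurable_funD.
exact: measurable_funD.
Qed.

(** For a measure with a density, the best [V] is half the total variation of the density in the
    direction [e]. *)
Definition variation_le e (V : R) nu :=
  forall t A, 0 <= t -> measurable A ->
    nu (translate e t @^-1` A) - nu A <= V * t.

Lemma variation_le_ge0 e V nu : variation_le e V nu -> 0 <= V.
Proof.
by move=> /(_ 1 setT ler01 measurableT); rewrite preimage_setT subrr mulr1.
Qed.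

Lemma variation_leW e V W nu : V <= W -> variation_le e V nu ->
  variation_le e W nu.
Proof.
by move=> VW H t A t0 mA; apply: le_trans (H t A t0 mA) _; rewrite ler_wpM2r.
Qed.

(** * Mass of thin strips around parallel lines *)

Definition strips (F : seq R) l (u v : R) : set plane :=
  [set z | exists2 c, c \in F & c + u <= lin l z < c + v].

Lemma measurable_strips F l u v : measurable (strips F l u v).
Proof.
have -> : strips F l u v = \bigcup_(c in [set` F]) lin l @^-1` `[c + u, c + v[.
  apply/seteqP; split=> z.
    by move=> [c cF H]; exists c => //=; rewrite in_itv.
  by move=> [c cF /=]; rewrite in_itv /= => H; exists c.
apply: fin_bigcup_measurable; first exact: finite_seq.
move=> c _; rewrite -[X in measurable X]setTI; exact: measurable_lin.
Qed.

Lemma strips_translate F l e s u v : lin l e = 1 ->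
  translate e s @^-1` strips F l u v = strips F l (u - s) (v - s).
Proof.
move=> le1; apply/seteqP; split=> z [c cF] H; exists c => //; move: H;
  rewrite lin_translate le1 => /andP[H1 H2]; apply/andP; split; lra.
Qed.

(** Stated on values, so that repetitions in the list are harmless. *)
Definition separated (F : seq R) (g : R) :=
  forall c d, c \in F -> d \in F -> `|c - d| < g -> c = d.

Lemma exists_separated F : exists2 g, 0 < g & separated F g.
Proof.
elim: F => [|a F [g g0 gF]]; first by exists 1.
have [h h0 hF] : exists2 h, 0 < h & forall d, d \in F -> `|a - d| < h -> a = d.
  elim: F {gF} => [|b F [h h0 hF]]; first by exists 1.
  have [ab|ab] := eqVneq a b.
    by exists h => // d; rewrite inE => /orP[/eqP->//|]; exact: hF.
  exists (Num.min h `|a - b|); first by rewrite lt_min h0/= normr_gt0 subr_eq0.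
  move=> d; rewrite inE lt_min => /orP[/eqP->|dF] /andP[H1 H2].
    by rewrite ltxx in H2.
  exact: hF.
exists (Num.min g h); first by rewrite lt_min g0.
move=> c d; rewrite !inE lt_min => /orP[/eqP->|cF] /orP[/eqP->|dF] /andP[H1 H2] //.
- exact: hF.
- by apply/esym/hF => //; rewrite distrC.
- exact: gF.
Qed.

(* adjacent strips are told apart by [separated] as long as their total width
   stays below the gap *)
Lemma strips_split nu F l u v w g : prob_content nu -> separated F g ->
  u <= v -> v <= w -> w - u <= g ->
  nu (strips F l u w) = nu (strips F l u v) + nu (strips F l v w).
Proof.
move=> [_ _ nuU] Fg uv vw wug; rewrite -nuU; try exact: measurable_strips.
- congr nu; apply/seteqP; split=> z.
    move=> [c cF /andP[H1 H2]]; have [H|H] := ltP (lin l z) (c + v).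
      by left; exists c => //; rewrite H1.
    by right; exists c => //; rewrite H.
  by move=> [] [c cF /andP[H1 H2]]; exists c => //; apply/andP; split; lra.
- rewrite -subset0 => z [[c cF /andP[H1 H2]] [d dF /andP[H3 H4]]].
  suff cd : c = d by move: H2 H3; rewrite cd => H2; rewrite leNgt H2.
  by apply: Fg => //; rewrite ltr_norml; apply/andP; split; lra.
Qed.

(** About [g / w] disjoint shifted copies of the strips fit between neighbouring lines. Each copy
    carries the same mass up to [V * w], and the total is at most 1. *)
Lemma nu_strips_le nu F l e V g u w : prob_content nu ->
  variation_le e V nu -> lin l e = 1 -> separated F g -> 0 < g ->
  0 < w -> nu (strips F l u (u + w)) <= (V + 2 / g) * w.
Proof.
move=> cnu Vnu le1 Fg g0 w0.
pose B (k : nat) := strips F l (u + k%:R * w) (u + k.+1%:R * w).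
have B0 : strips F l u (u + w) = B 0%N by rewrite /B mul0r addr0 mul1r.
have V0 := variation_le_ge0 Vnu.
have mB k : measurable (B k) by exact: measurable_strips.
pose n := Num.truncn (g / w).
have gw0 : 0 <= g / w by rewrite divr_ge0// ltW.
have /andP[n1 n2] : n%:R <= g / w < n.+1%:R by exact: truncn_itv.
have nwg : n%:R * w <= g by rewrite -ler_pdivlMr.
(* Shifting block 0 onto block [k] would cost [k * V * w]. Instead the union of blocks 0 to [k - 1]
   is compared with that of blocks 1 to [k], a single shift by [w]; their complements in the union
   of blocks 0 to [k] are block [k] and block 0. *)
have step k : (k < n)%N -> nu (B 0%N) <= nu (B k) + V * w.
  move=> kn.
  have kwg : k.+1%:R * w <= g.
    by apply: le_trans nwg; rewrite ler_pM2r// ler_nat.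
  have k0 : 0 <= k%:R * w by rewrite mulr_ge0// ltW.
  have k1E : k.+1%:R * w = k%:R * w + w by rewrite -natr1 mulrDl mul1r.
  have E1 := @strips_split nu F l u (u + w) (u + k.+1%:R * w) g cnu Fg
    ltac:(lra) ltac:(lra) ltac:(lra).
  have E2 := @strips_split nu F l u (u + k%:R * w) (u + k.+1%:R * w) g cnu Fg
    ltac:(lra) ltac:(lra) ltac:(lra).
  have := Vnu w (strips F l (u + w) (u + k.+1%:R * w)) (ltW w0)
    (measurable_strips _ _ _ _).
  rewrite strips_translate// k1E [u + (_ + _)]addrA !addrK.
  rewrite -B0.
  rewrite -/(B k) in E2.
  rewrite -addrA -k1E; lra.
have total k : (k <= n)%N ->
    k%:R * nu (B 0%N) <= nu (strips F l u (u + k%:R * w)) + k%:R * (V * w).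
  elim: k => [_|k IH kn].
    rewrite !mul0r !addr0; case: cnu => nu0 _ _; by apply: nu0; exact: measurable_strips.
  have {}IH := IH (ltnW kn); have S := step k kn.
  have k0 : 0 <= k%:R * w by rewrite mulr_ge0// ltW.
  have kwg : k.+1%:R * w <= g.
    by apply: le_trans nwg; rewrite ler_pM2r// ler_nat.
  have k1E : k.+1%:R * w = k%:R * w + w by rewrite -natr1 mulrDl mul1r.
  have E2 := @strips_split nu F l u (u + k%:R * w) (u + k.+1%:R * w) g cnu Fg
    ltac:(lra) ltac:(lra) ltac:(lra).
  rewrite E2 -/(B k) -natr1 !mulrDl !mul1r; lra.
have H1 := total n (leqnn n).
have H2 := prob_content_le1 cnu (measurable_strips F l u (u + n%:R * w)).
have H3 := prob_content_le1 cnu (mB 0%N).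
have : n.+1%:R * nu (B 0%N) <= n.+1%:R * ((V + 2 / g) * w).
  (* Since [g / w < n + 1], the factor 2 pays for the total mass and for one extra copy of block 0;
     this also covers [n = 0]. *)
  have : 2 <= n.+1%:R * (2 / g * w).
    rewrite (_ : _ * _ = 2 * (n.+1%:R * w / g)); last by field; rewrite gt_eqF.
    rewrite ler_peMr// ler_pdivlMr// mul1r -ler_pdivrMr//; exact: ltW.
  move=> H4; have Vw : 0 <= V * w by rewrite mulr_ge0// ltW.
  by rewrite -natr1 in H4 *; lra.
by rewrite ler_pM2l// B0.
Qed.

Lemma translate0 e : translate e 0 = id.
Proof. by apply/funext => -[x y]; rewrite /translate/= !mul0r !addr0. Qed.

(** * Cut lines and the Lasota-Yorke inequality *)

Definition forms : seq plane := [:: (1, 0); (0, 1); (1, 1)].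

(* The cells of [G] are cut out by lines from the three families [forms], at the
   levels in [F]; inside a cell [G] expands the direction [e] by [k]. *)
Definition expands_off_cuts (G : plane -> plane) (k : R) (F : seq R) e :=
  forall z s, 0 <= s ->
    (forall l c, l \in forms -> lin l e = 1 -> c \in F ->
       ~~ (lin l z <= c <= lin l z + s)) ->
    G (translate e s z) = translate e (k * s) (G z).

(* A Lasota-Yorke inequality. Parallel cuts are [g] apart, so the strips around
   the lines of one family are disjoint up to scale [g], and the coefficient of
   [V] only counts the families, not the cuts. *)
Lemma variation_le_preimage G k F e : measurable_fun setT G -> 0 < k ->
  expands_off_cuts G k F e ->
  exists2 K, 0 <= K & forall nu V, prob_content nu -> variation_le e V nu ->
    variation_le e ((7 * V + K) / k) (fun A => nu (G @^-1` A)).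
Proof.
move=> mG k0 Gk; have [g g0 Fg] := exists_separated F.
exists (12 / g); first by rewrite divr_ge0// ltW.
move=> nu V cnu Vnu t A t0 mA.
have V0 := variation_le_ge0 Vnu.
have mGA : measurable (G @^-1` A) by rewrite -[X in measurable X]setTI; exact: mG.
have [->|tn0] := eqVneq t 0.
  by rewrite translate0 preimage_id subrr mulr0.
(* A shift by [s] before [G] is a shift by [k * s = t] after it; this yields the gain [1 / k]. *)
pose s := t / k; have s0 : 0 < s by rewrite divr_gt0// lt_neqAle eq_sym tn0.
have tE : t = k * s by rewrite mulrC divfK// gt_eqF.
(* A cut is met when [c - s <= lin l z <= c]; the width [2 * s] lets a half-open strip contain the
   endpoint [c]. *)
pose bad l := if lin l e == 1 then strips F l (- s) (- s + 2 * s) else set0.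
have mbad l : measurable (bad l).
  by rewrite /bad; case: ifP => // _; exact: measurable_strips.
have nubad l : nu (bad l) <= (V + 2 / g) * (2 * s).
  rewrite /bad; case: ifPn => [/eqP le1|_].
    by apply: (@nu_strips_le nu F l e) => //; rewrite mulr_gt0.
  have -> : nu set0 = 0.
    have [_ _ /(_ set0 set0)] := cnu; rewrite setU0 setI0 => /(_ _ _ _)H.
    have := H measurable0 measurable0 erefl; lra.
  apply: mulr_ge0; last by rewrite mulr_ge0// ltW.
  by rewrite addr_ge0// divr_ge0// ltW.
have mS : measurable (translate e s @^-1` (G @^-1` A)).
  by rewrite -[X in measurable X]setTI; exact: measurable_translate.
have mGS : measurable (G @^-1` (translate e t @^-1` A)).
  rewrite -[X in measurable X]setTI; apply: mG => //.
  by rewrite -[X in measurable X]setTI; exact: measurable_translate.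
have sub : G @^-1` (translate e t @^-1` A) `<=`
    translate e s @^-1` (G @^-1` A) `|` (bad (1, 0) `|` (bad (0, 1) `|` bad (1, 1))).
  move=> z /= Az; have [H|H] := pselect (forall l c, l \in forms ->
      lin l e = 1 -> c \in F -> ~~ (lin l z <= c <= lin l z + s)).
    by left; rewrite /= (Gk z s (ltW s0) H) -tE.
  right; have [l lf badz] : exists2 l, l \in forms & bad l z.
    apply: contrapT => nbad; apply: H => l c lf le1 cF; apply/negP => /andP[h1 h2].
    apply: nbad; exists l => //; rewrite /bad le1 eqxx; exists c => //.
    by apply/andP; split; lra.
  move: lf badz; rewrite !inE => /or3P[] /eqP-> badz;
    [by left|by right; left|by right; right].
have m2 := measurableU _ _ (mbad (0, 1)) (mbad (1, 1)).
have m3 := measurableU _ _ (mbad (1, 0)) m2.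
have h1 := prob_content_le cnu mGS (measurableU _ _ mS m3) sub.
have h2 := prob_content_leU cnu mS m3.
have h3 := prob_content_leU cnu (mbad (1, 0)) m2.
have h4 := prob_content_leU cnu (mbad (0, 1)) (mbad (1, 1)).
have h5 := Vnu s _ (ltW s0) mGA.
have h6 := nubad (1, 0); have h7 := nubad (0, 1); have h8 := nubad (1, 1).
(* The coefficient is [7 = 1 + 3 * 2]: one [V * s] for the shift itself, and a strip of width
   [2 * s] for each of the three families. *)
have -> : (7 * V + 12 / g) / k * t = V * s + 3 * ((V + 2 / g) * (2 * s)).
  by rewrite tE; field; rewrite ?gt_eqF.
lra.
Qed.

(** * Piecewise affine maps with three cut lines, and their iterates *)

Section PiecewiseAffine.
Variables (b c1 c2 c3 : R) (q : bool -> bool -> bool -> plane).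

(** Strict comparisons for the coordinates and a wide one for the sum match the half-open cells of
    the greedy and lazy maps. *)
Definition digit z := q (z.1 < c1) (z.2 < c2) (z.1 + z.2 <= c3).

Definition pwmap z : plane := (b * z.1 - (digit z).1, b * z.2 - (digit z).2).

Lemma measurable_pwmap : measurable_fun setT pwmap.
Proof.
have m1 : measurable_fun setT (fun z : plane => z.1 < c1).
  by apply: measurable_fun_ltr => //.
have m2 : measurable_fun setT (fun z : plane => z.2 < c2).
  by apply: measurable_fun_ltr => //.
have m3 : measurable_fun setT (fun z : plane => z.1 + z.2 <= c3).
  by apply: measurable_fun_ler => //; apply: measurable_funD;
    [exact: measurable_fst|exact: measurable_snd].
pose aff d z : plane := (b * z.1 - d.1, b * z.2 - d.2).
have maff d : measurable_fun setT (aff d).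
  apply/measurable_fun_pairP; split; rewrite /comp/=.
    by apply: measurable_funB => //; apply: measurable_funM => //.
  by apply: measurable_funB => //; apply: measurable_funM => //.
pose f z :=
    if z.1 < c1 then if z.2 < c2 then
      if z.1 + z.2 <= c3 then aff (q true true true) z else aff (q true true false) z
    else if z.1 + z.2 <= c3 then aff (q true false true) z
      else aff (q true false false) z
    else if z.2 < c2 then
      if z.1 + z.2 <= c3 then aff (q false true true) z else aff (q false true false) z
    else if z.1 + z.2 <= c3 then aff (q false false true) z
      else aff (q false false false) z.
have fE : f = pwmap.
  apply/funext => z; rewrite /pwmap /digit /f.
  by case: (z.1 < c1); case: (z.2 < c2); case: (z.1 + z.2 <= c3).
rewrite -fE.
by do !apply: measurable_fun_ifT.
Qed.

Lemma measurable_iter_pwmap n : measurable_fun setT (iter n pwmap).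
Proof.
elim: n => [|n IH]; first exact: measurable_id.
exact: (measurableT_comp measurable_pwmap IH).
Qed.

(** A form vanishing on [e] is constant along the segment. For the others, a closed range of values
    avoiding [c] keeps both the strict and the wide comparison with [c] unchanged. *)
Lemma pwmap_expands e z t : 0 <= t ->
  (forall l, l \in forms -> lin l e = 0 \/ lin l e = 1) ->
  (forall l c, l \in forms -> lin l e = 1 -> c \in [:: c1; c2; c3] ->
       ~~ (lin l z <= c <= lin l z + t)) ->
  pwmap (translate e t z) = translate e (b * t) (pwmap z).
Proof.
move=> t0 fe Hcut.
have dE : digit (translate e t z) = digit z.
  have key l c : l \in forms -> c \in [:: c1; c2; c3] ->
      (lin l (translate e t z) < c) = (lin l z < c) /\
      (lin l (translate e t z) <= c) = (lin l z <= c).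
    move=> lf cF; rewrite lin_translate; case: (fe l lf) => le1; rewrite le1.
      by rewrite mulr0 addr0.
    have := Hcut l c lf le1 cF; rewrite mulr1 => H.
    have [h|h] := ltP (lin l z) c.
      move: H; rewrite (ltW h)/= -ltNge => h'; split; [by rewrite h'|by rewrite ltW].
    have nh : lin l z == c = false.
      by apply/negP => /eqP E; move: H; rewrite E lexx lerDl t0.
    have h2 : c < lin l z by rewrite lt_neqAle eq_sym nh.
    split; apply/negP/negP; rewrite -?leNgt -?ltNge; lra.
  rewrite /digit.
  have [e1 _] := key (1, 0) c1 ltac:(by rewrite !inE eqxx)
    ltac:(by rewrite !inE eqxx).
  have [e2 _] := key (0, 1) c2 ltac:(by rewrite !inE eqxx ?orbT)
    ltac:(by rewrite !inE eqxx ?orbT).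
  have [_ e3] := key (1, 1) c3 ltac:(by rewrite !inE eqxx ?orbT)
    ltac:(by rewrite !inE eqxx ?orbT).
  move: e1 e2 e3; rewrite /lin/= !mul1r !mul0r !addr0 !add0r.
  by move=> -> -> ->.
by rewrite /pwmap dE /translate /=; congr pair; ring.
Qed.

(** Each branch of the iterate is [b ^+ n * z - d], so the line at level [c] pulls back to a
    parallel line at level [(c + lin l d) / b ^+ n]. *)
Lemma iter_pwmap_cuts e n : 0 < b ->
  (forall l, l \in forms -> lin l e = 0 \/ lin l e = 1) ->
  exists F, expands_off_cuts (iter n pwmap) (b ^+ n) F e.
Proof.
move=> b0 fe.
(* The finite list [Q] of translation parts goes through the induction, since the next cuts are
   computed from it. *)
suff [Q [F [_ H]]] : exists (Q : seq plane) (F : seq R),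
    (forall z, exists2 d, d \in Q &
      iter n pwmap z = (b ^+ n * z.1 - d.1, b ^+ n * z.2 - d.2)) /\
    expands_off_cuts (iter n pwmap) (b ^+ n) F e by exists F.
elim: n => [|n [Q [F [QH FH]]]].
  exists [:: (0, 0)], [::]; split.
    move=> [x y]; exists (0, 0); first by rewrite inE.
    by rewrite /= !expr0 !mul1r !subr0.
  by move=> z s _ _; rewrite expr0 mul1r.
pose digits := [seq q u.1.1 u.1.2 u.2 | u <- enum {: bool * bool * bool}].
exists [seq (b * d.1 + d'.1, b * d.2 + d'.2) | d <- Q, d' <- digits].
exists (F ++ [seq (u.2 + lin u.1.1 u.1.2) / b ^+ n |
  u <- [seq (v, c) | v <- [seq (l, d) | l <- forms, d <- Q], c <- [:: c1; c2; c3]]]).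
have bn0 : 0 < b ^+ n by rewrite exprn_gt0.
split=> [z|z s s0 H].
  have [d dQ E] := QH z.
  exists (b * d.1 + (digit (iter n pwmap z)).1, b * d.2 + (digit (iter n pwmap z)).2).
    apply/allpairsP; exists (d, digit (iter n pwmap z)); split => //=.
    apply/mapP; exists ((iter n pwmap z).1 < c1, (iter n pwmap z).2 < c2,
      (iter n pwmap z).1 + (iter n pwmap z).2 <= c3) => //.
    by rewrite mem_enum.
  by rewrite iterS {1}/pwmap {1 3}E /= exprS; congr pair; ring.
have En : iter n pwmap (translate e s z) = translate e (b ^+ n * s) (iter n pwmap z).
  by apply: FH => // l c lf le1 cF; apply: H => //; rewrite mem_cat cF.
rewrite !iterS En pwmap_expands//; first by rewrite exprS mulrA.
  by rewrite mulr_ge0// ltW.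
move=> l c lf le1 cc; have [d dQ E] := QH z.
have cF : (c + lin l d) / b ^+ n \in F ++ [seq (u.2 + lin u.1.1 u.1.2) / b ^+ n |
    u <- [seq (v, c) | v <- [seq (l, d) | l <- forms, d <- Q], c <- [:: c1; c2; c3]]].
  rewrite mem_cat; apply/orP; right; apply/mapP; exists ((l, d), c) => //.
  by apply: (allpairs_f _ _ cc); apply: (allpairs_f _ lf dQ).
apply: contra (H l _ lf le1 cF).
have -> : lin l (iter n pwmap z) = b ^+ n * lin l z - lin l d.
  by rewrite E /lin/=; ring.
move=> /andP[h1 h2]; rewrite ler_pdivlMr// ler_pdivrMr//; apply/andP; split; lra.
Qed.

(* Passing to a power of the map makes the expansion beat the coefficient 7 of the
   Lasota-Yorke inequality. *)
Lemma iter_pwmap_variation e nu : 1 < b ->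
  (forall l, l \in forms -> lin l e = 0 \/ lin l e = 1) ->
  prob_content nu -> variation_le e 1 nu ->
  exists2 C, 0 <= C & forall n,
    variation_le e C (fun A => nu (iter n pwmap @^-1` A)).
Proof.
move=> b1 fe cnu V1; have b0 : 0 < b by apply: lt_trans b1.
have bn0 n : 0 < b ^+ n by rewrite exprn_gt0.
have /choice[K HK] n : exists K, 0 <= K /\ forall nu V, prob_content nu ->
    variation_le e V nu -> variation_le e ((7 * V + K) / b ^+ n)
      (fun A => nu (iter n pwmap @^-1` A)).
  have [F HF] := iter_pwmap_cuts n b0 fe.
  have [L L0 HL] := variation_le_preimage (measurable_iter_pwmap n) (bn0 n) HF.
  by exists L.
(* The value 8 exceeds the coefficient 7 by one, which leaves one [C] to absorb [K N]. Bernoulli's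
   inequality provides [N]. *)
have [N N8] : exists N, 8 <= b ^+ N.
  have bern n : 1 + n%:R * (b - 1) <= b ^+ n.
    elim: n => [|n IH]; first by rewrite mul0r addr0 expr0.
    rewrite exprS -natr1; have : 0 <= n%:R * (b - 1) ^+ 2 :> R.
      by rewrite mulr_ge0// sqr_ge0.
    have : b * (1 + n%:R * (b - 1)) <= b * b ^+ n by rewrite ler_pM2l.
    lra.
  have [N HN] : exists N, 7 / (b - 1) < N%:R.
    exists (Num.truncn (7 / (b - 1))).+1; exact: truncnS_gt.
  exists N; apply: le_trans (bern N).
  by move: HN; rewrite ltr_pdivrMr ?subr_gt0// => HN; lra.
(* This dominates [7 + K n] for every [n <= N], hence the iterates up to [N]; a later iterate
   inherits the bound from the one [N] steps before. *)
pose C := 7 + \sum_(j < N.+1) K j.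
have KC n : (n <= N)%N -> 7 + K n <= C.
  move=> nN; rewrite lerD2l (bigD1 (Ordinal (nN : (n < N.+1)%N)))//= lerDl.
  by apply: sumr_ge0 => i _; have [] := HK i.
have C0 : 0 <= C by rewrite addr_ge0// sumr_ge0// => i _; have [] := HK i.
exists C => // n; elim/ltn_ind: n => n IH.
have [nN|Nn] := leqP n N.
  apply: variation_leW ((HK n).2 _ _ cnu V1); rewrite mulr1 ler_pdivrMr//.
  apply: le_trans (KC n nN) _; rewrite ler_peMr//.
  by rewrite exprn_ege1// ltW.
have N0 : (0 < N)%N by case: (N) N8 => //; rewrite expr0 => ?; lra.
have {}IH := IH (n - N)%N ltac:(by rewrite ltn_subrL N0 (leq_trans _ Nn)).
have cm := prob_content_preimage (measurable_iter_pwmap (n - N)) cnu.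
have := (HK N).2 _ _ cm IH.
have -> : (fun A => nu (iter (n - N) pwmap @^-1` (iter N pwmap @^-1` A))) =
    (fun A => nu (iter n pwmap @^-1` A)).
  apply/funext => A; congr nu; rewrite -[in RHS](subnKC (ltnW Nn)).
  by apply/funext => z; rewrite /preimage/= iterD.
apply: variation_leW; rewrite ler_pdivrMr//.
have := KC N (leqnn N) => h1; have : C * 8 <= C * b ^+ N by rewrite ler_wpM2l.
lra.
Qed.

End PiecewiseAffine.
End Content.

(** * Lebesgue measure on the plane and the initial square *)

Section PlaneLebesgue.
Context {R : realType}.
Local Notation plane := (R * R)%type.
Local Notation leb := (@lebesgue_measure R).
Implicit Types (z e w : plane) (A B : set plane).

(* [leb2] comes with the display of [measurableTypeR R]; [area] is the same
   function on the canonical measurable structure of the plane, whose measurable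
   sets agree by conversion. *)
Definition area : set plane -> \bar R := @leb2 R.

Let area0 : area set0 = 0%E. Proof. exact: measure0. Qed.

Let area_ge0 A : (0 <= area A)%E. Proof. exact: measure_ge0. Qed.

Let area_sigma_additive : semi_sigma_additive area.
Proof. exact: (@measure_semi_sigma_additive _ _ _ (leb \x leb)%E). Qed.

HB.instance Definition _ := isMeasure.Build _ plane R area
  area0 area_ge0 area_sigma_additive.

Lemma areaX (A B : set R) : measurable A -> measurable B ->
  area (A `*` B) = (leb A * leb B)%E.
Proof. by move=> mA mB; exact: (product_measure1E leb leb mA mB). Qed.

Let area_sigma_finite : sigma_finite setT area.
Proof.
exists (fun n => `[- n%:R, n%:R]%classic `*` `[- n%:R, n%:R]%classic).
  apply/esym; rewrite -subTset => -[x y] _.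
  exists (maxn (Num.truncn `|x|).+1 (Num.truncn `|y|).+1) => //=.
  rewrite !in_itv/= -!ler_norml !ltW//.
    by apply: (lt_le_trans (truncnS_gt _)); rewrite ler_nat leq_maxr.
  by apply: (lt_le_trans (truncnS_gt _)); rewrite ler_nat leq_maxl.
move=> n; split; first exact: measurableX.
rewrite areaX// lebesgue_measure_itv/= lte_fin.
by case: ifP => _; rewrite -?EFinD -?EFinM ?mul0e ltry.
Qed.

HB.instance Definition _ := Measure_isSigmaFinite.Build _ plane R area
  area_sigma_finite.

(** Half-open intervals determine Lebesgue measure, and translation preserves their length. *)
Lemma lebesgue_measure_translate (a : R) (A : set R) : measurable A ->
  leb ((fun x => x + a) @^-1` A) = leb A.
Proof.
move=> mA; apply/esym.
pose f : R -> measurableTypeR R := fun x => x + a.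
have mf : measurable_fun [set: measurableTypeR R] f by exact: measurable_funD.
apply: (@lebesgue_measure_unique R (pushforward leb f)) => // _ [[c d] _ <-].
have E : f @^-1` `]c, d]%classic = `]c - a, d - a]%classic.
  by apply/seteqP; split=> x; rewrite /= !in_itv/= /f ltrBlDr lerBrDr.
change (leb `]c, d]%classic = leb (f @^-1` `]c, d]%classic)).
rewrite E !lebesgue_measure_itv/= !lte_fin ltrD2r.
by rewrite -!EFinD; case: ifP => // _; congr EFin; ring.
Qed.

(** Rectangles determine the product measure, and the one-dimensional invariance applies to each
    factor. *)
Lemma area_translate e (s : R) A : measurable A -> area (translate e s @^-1` A) = area A.
Proof.
move=> mA; apply/esym.
pose pR := measurableTypeR R.
pose g : pR * pR -> pR * pR := translate e s.
have mg : measurable_fun [set: pR * pR] g by exact: measurable_translate.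
apply: (@product_measure_unique _ _ _ _ R leb leb (pushforward (leb \x leb)%E g))
  => // B C mB mC.
change (area (((fun x => x + s * e.1) @^-1` B) `*` ((fun x => x + s * e.2) @^-1` C))
  = (leb B * leb C)%E).
have mt (a : R) (D : set R) : measurable D -> measurable ((fun x => x + a) @^-1` D).
  by move=> mD; rewrite -[X in measurable X]setTI; apply: measurable_funD.
by rewrite areaX ?lebesgue_measure_translate//; exact: mt.
Qed.

Definition box (t : R) : set plane := `[0, t]%classic `*` `[0, t]%classic.

Lemma measurable_box t : measurable (box t).
Proof. exact: measurableX. Qed.

Lemma area_box t : 0 <= t -> area (box t) = (t ^+ 2)%:E.
Proof.
move=> t0; rewrite /box areaX// !lebesgue_measure_itv/= !lte_fin.
move: t0; rewrite le_eqVlt => /orP[/eqP<-|t0].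
  by rewrite ltxx mule0 expr0n.
by rewrite t0 -!EFinD subr0 -EFinM expr2.
Qed.

Local Notation Q := (box 1).

Definition unit_square_content A : R := fine (area (Q `&` A)).

Lemma area_unit_fin A : measurable A -> area (Q `&` A) \is a fin_num.
Proof.
move=> mA; rewrite ge0_fin_numE//; apply: (@le_lt_trans _ _ (area Q)).
  apply: le_measure; rewrite ?inE//; first exact: measurableI (measurable_box _) mA.
  exact: measurable_box.
by rewrite area_box// ltry.
Qed.

Lemma unit_square_prob_content : prob_content unit_square_content.
Proof.
split=> [A mA||A B mA mB AB].
- by rewrite fine_ge0.
- by rewrite /unit_square_content setIT area_box//= expr1n.
- rewrite /unit_square_content setIUr measureU.
  + by rewrite fineD// area_unit_fin.
  + exact: measurableI (measurable_box _) mA.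
  + exact: measurableI (measurable_box _) mB.
  + by rewrite setIACA AB setI0.
Qed.

(** A point of the square that the shift sends into [A] either stays in the square, which by
    translation invariance accounts for at most the content of [A], or leaves it. *)
Lemma unit_square_variation e :
  (forall t : R, 0 <= t -> (area (Q `\` translate e t @^-1` Q) <= t%:E)%E) ->
  variation_le e 1 unit_square_content.
Proof.
move=> He t A t0 mA; rewrite mul1r lerBlDr.
have mQ := measurable_box 1.
have mS B : measurable B -> measurable (translate e t @^-1` B).
  by move=> mB; rewrite -[X in measurable X]setTI; exact: measurable_translate.
have mD : measurable (Q `\` translate e t @^-1` Q) by apply: measurableD => //; exact: mS.
have mQA : measurable (Q `&` A) by exact: measurableI.
rewrite -lee_fin EFinD /unit_square_content !fineK ?area_unit_fin//; last exact: mS.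
rewrite -(area_translate e t mQA).
apply: le_trans (leeD2r _ (He t t0)).
apply: le_trans (measureU2 _ mD (mS _ mQA)).
apply: le_measure; rewrite ?inE.
- by apply: measurableI => //; exact: mS.
- by apply: measurableU => //; exact: mS.
- move=> z [Qz Az]; have [H|H] := pselect (Q (translate e t z)).
    by right; split.
  by left; split.
Qed.

(** The points pushed out of the square lie in a margin of width [t] along its right side. *)
Lemma unit_square_variation1 : variation_le (1, 0) 1 unit_square_content.
Proof.
apply: unit_square_variation => t t0.
have mI : measurable (`]1 - t, 1]%classic `*` `[0, 1]%classic : set plane).
  exact: measurableX.
apply: (@le_trans _ _ (area (`]1 - t, 1]%classic `*` `[0, 1]%classic))).
  apply: le_measure; rewrite ?inE//.
    apply: measurableD; first exact: measurable_box.
    rewrite -[X in measurable X]setTI; apply: measurable_translate => //.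
    exact: measurable_box.
  move=> [x y] []; rewrite /box/= !in_itv/= mulr1 mulr0 addr0.
  move=> [/andP[x0 x1] /andP[y0 y1]] H; rewrite x1 y0 y1 andbT; split => //.
  by rewrite ltNge; apply/negP => h; apply: H; split; apply/andP; split; lra.
rewrite areaX//= !lebesgue_measure_itv/= !lte_fin ltr01.
case: ifP => _; last by rewrite mul0e lee_fin.
by rewrite -!EFinD -EFinM lee_fin; lra.
Qed.

Lemma unit_square_variation2 : variation_le (0, 1) 1 unit_square_content.
Proof.
apply: unit_square_variation => t t0.
have mI : measurable (`[0, 1]%classic `*` `]1 - t, 1]%classic : set plane).
  exact: measurableX.
apply: (@le_trans _ _ (area (`[0, 1]%classic `*` `]1 - t, 1]%classic))).
  apply: le_measure; rewrite ?inE//.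
    apply: measurableD; first exact: measurable_box.
    rewrite -[X in measurable X]setTI; apply: measurable_translate => //.
    exact: measurable_box.
  move=> [x y] []; rewrite /box/= !in_itv/= mulr1 mulr0 addr0.
  move=> [/andP[x0 x1] /andP[y0 y1]] H; rewrite y1 x0 x1 andbT; split => //.
  by rewrite ltNge; apply/negP => h; apply: H; split; apply/andP; split; lra.
rewrite areaX//= !lebesgue_measure_itv/= !lte_fin ltr01.
case: ifP => _; last by rewrite mule0 lee_fin.
by rewrite -!EFinD -EFinM lee_fin; lra.
Qed.

(** Passing to the complement of [A] reverses the one-sided bound. *)
Lemma variation_le_sub nu e V t A : prob_content nu -> variation_le e V nu ->
  0 <= t -> measurable A -> nu A - V * t <= nu (translate e t @^-1` A).
Proof.
move=> cnu Vnu t0 mA.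
have mtA : measurable (translate e t @^-1` A).
  by rewrite -[X in measurable X]setTI; exact: measurable_translate.
have := Vnu t (~` A) t0 (measurableC mA).
rewrite preimage_setC !prob_contentC//; lra.
Qed.

(* Averaging over translations by a box of side [t] compares a measure of bounded
   variation with its convolution, whose density is at most [t ^- 2]. *)
Lemma area_bound (G : plane -> plane) C t A :
  let nu A := unit_square_content (G @^-1` A) in
  measurable_fun setT G -> 0 <= C ->
  variation_le (1, 0) C nu -> variation_le (0, 1) C nu ->
  0 < t -> measurable A ->
  ((t ^+ 2 * (nu A - 2 * C * t))%:E <= area A)%E.
Proof.
move=> nu mG C0 V1 V2 t0 mA.
have cnu : prob_content nu.
  exact: (prob_content_preimage mG unit_square_prob_content).
(* A nonpositive bound is trivial; a positive one can be integrated as a nonnegative constant. *)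
have [le0|gt0] := leP (nu A - 2 * C * t) 0.
  apply: (@le_trans _ _ 0%E) => //.
  by rewrite lee_fin mulr_ge0_le0// sqr_ge0.
have mtr B e (s : R) : measurable B -> measurable (translate e s @^-1` B).
  by move=> mB; rewrite -[X in measurable X]setTI; exact: measurable_translate.
pose h (p : plane * plane) : plane := translate p.1 1 (G p.2).
have mG2 : measurable_fun setT (fun p : plane * plane => G p.2).
  exact: (measurableT_comp mG measurable_snd).
have mh : measurable_fun setT h.
  apply/measurable_fun_pairP; split.
    apply: measurable_funD.
      exact: (measurableT_comp measurable_fst mG2).
    apply: measurable_funM => //.
    exact: (measurableT_comp measurable_fst measurable_fst).
  apply: measurable_funD.
    exact: (measurableT_comp measurable_snd mG2).
  apply: measurable_funM => //.
  exact: (measurableT_comp measurable_snd measurable_fst).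
(* The pairs [(w, z)] with [G z + w] in [A]. Sections at fixed [w] have area at least
   [nu A - 2 * C * t], those at fixed [z] at most [area A]; integrating both ways gives the
   claim. *)
pose D : set (plane * plane) := (box t `*` Q) `&` h @^-1` A.
have mD : measurable D.
  apply: measurableI; first by apply: measurableX; exact: measurable_box.
  by rewrite -[X in measurable X]setTI; exact: mh.
have lower w : box t w -> ((nu A - 2 * C * t)%:E <= area (xsection D w))%E.
  rewrite /box/= !in_itv/= => -[/andP[w10 w1t] /andP[w20 w2t]].
  have -> : xsection D w = Q `&` G @^-1` (translate w 1 @^-1` A).
    apply/seteqP; split=> z; rewrite /xsection/= inE.
      by move=> [[_ Qz] Az].
    by move=> [Qz Az]; split=> //; split => //; rewrite /box/= !in_itv/= w10 w20.
  rewrite -[leRHS]fineK; last first.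
    apply: area_unit_fin; rewrite -[X in measurable X]setTI; apply: mG => //.
    exact: mtr.
  rewrite lee_fin -/(unit_square_content _) -/(nu _).
  have -> : translate w 1 @^-1` A =
      translate (1, 0) w.1 @^-1` (translate (0, 1) w.2 @^-1` A).
    apply/seteqP; split=> z; rewrite /preimage/translate/=;
      by rewrite !mulr1 !mulr0 !mul1r !addr0.
  have h1 := variation_le_sub cnu V1 w10 (mtr _ (0, 1) w.2 mA).
  have h2 := variation_le_sub cnu V2 w20 mA.
  have h3 : C * w.1 <= C * t by rewrite ler_wpM2l.
  have h4 : C * w.2 <= C * t by rewrite ler_wpM2l.
  lra.
have upper z : (area (ysection D z) <= area A * (\1_Q z)%:E)%E.
  rewrite indicE; have [Qz|nQz] := boolP (z \in Q); last first.
    rewrite mule0; have -> : ysection D z = set0; last by rewrite measure0.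
    rewrite -subset0 => w; rewrite /ysection/= inE => -[[_ Qz] _].
    by rewrite (mem_set Qz) in nQz.
  rewrite mule1 -(area_translate (G z) 1 mA).
  apply: le_measure; rewrite ?inE; first exact: measurable_ysection.
    exact: mtr.
  move=> w; rewrite /ysection/= inE => -[_]; rewrite /h /preimage/= /translate.
  by rewrite !mul1r [w.1 + _]addrC [w.2 + _]addrC.
have -> : area A = (\int[area]_z (area A * (\1_Q z)%:E))%E.
  rewrite ge0_integralZl//.
  - rewrite integral_indic//; last exact: (measurable_box 1).
    by rewrite setIT /= area_box// expr1n mule1.
  - apply/measurable_EFinP; exact: (measurable_indic (measurable_box 1)).
apply: (@le_trans _ _ (\int[area]_z (area (ysection D z)))%E); last first.
  apply: ge0_le_integral => //.
  - exact: measurable_fun_ysection.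
  - apply: measurable_funeM; apply/measurable_EFinP.
    exact: (measurable_indic (measurable_box 1)).
change (((t ^+ 2 * (nu A - 2 * C * t))%:E <= (area \x^ area) D)%E).
(* Exchange of the order of integration: both iterated integrals are the product measure of [D]. *)
rewrite -(@product_measure_unique _ _ _ _ R area area (area \x^ area)%E)//; last first.
  by move=> X Y mX mY; exact: product_measure2E.
rewrite /product_measure1.
apply: (@le_trans _ _ (\int[area]_(w in box t) (area (xsection D w)))%E); last first.
  apply: ge0_subset_integral => //; first exact: measurable_box.
  exact: measurable_fun_xsection.
apply: (@le_trans _ _ (\int[area]_(w in box t) (nu A - 2 * C * t)%:E)%E).
  rewrite integral_cst; last exact: measurable_box.
  by rewrite /= area_box ?(ltW t0)// -EFinM mulrC.
apply: ge0_le_integral => //.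
- exact: measurable_box.
- by move=> w _; rewrite lee_fin ltW.
- by apply: measurable_funTS; exact: measurable_fun_xsection.
Qed.

End PlaneLebesgue.

(** * Limits along ultrafilters and recovery of countable additivity *)

Section Limit.
Context {R : realType}.
Local Notation plane := (R * R)%type.
Implicit Types (z : plane) (A B : set plane).

(** Compactness gives a cluster point, and an ultrafilter converges to each of its cluster
    points. *)
Lemma bounded_ultra_cvg (T : Type) (U : set_system T) (u : T -> R) (a c : R) :
  UltraFilter U -> (forall x, a <= u x <= c) -> cvg (u @ U).
Proof.
move=> UU u01; have /(_ (u @ U) _ _)[] := @segment_compact R a c.
  change (U (u @^-1` `[a, c])); apply: filterS filterT => x _ /=.
  by rewrite in_itv/= u01.
move=> p [_ clp]; apply/cvg_ex; exists p => B pB.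
have [//|UB] := in_ultra_setVsetC (u @^-1` B) UU.
have [y [/= nBy By]] := clp (~` B) B UB pB.
by [].
Qed.

(* Uniform absolute continuity with respect to a finite measure rules out any loss
   of mass in a countable union. *)
Lemma prob_content_sigma_additive (m : set plane -> R) (S : set plane) (C : R) :
  prob_content m -> measurable S -> (area S < +oo)%E ->
  (forall t A, 0 < t -> measurable A ->
    m A <= C * t + fine (area (S `&` A)) / t ^+ 2) ->
  semi_sigma_additive (fun A => (`|m A|)%:E).
Proof.
move=> cm mS Sfin mC F mF tF mUF; have [m0 _ mU] := cm.
pose tail n := \bigcup_(k in [set k | (n <= k)%N]) F k.
have mtail n : measurable (tail n) by apply: bigcup_measurable => k _; exact: mF.
have tail0 : tail 0%N = \bigcup_k F k.
  by apply/seteqP; split=> z [k _ Fk]; exists k.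
have tailS n : m (tail n) = m (F n) + m (tail n.+1).
  rewrite -mU//.
    congr m; apply/seteqP; split=> z.
      move=> [k /=]; rewrite leq_eqVlt => /orP[/eqP<-|nk] Fk; first by left.
      by right; exists k.
    by move=> [Fn|[k /= nk Fk]]; [exists n => //=|exists k => //=; exact: ltnW].
  rewrite -subset0 => z [Fn [k /= nk Fk]].
  have /trivIsetP/(_ n k I I) := tF; rewrite neq_ltn nk => /(_ isT).
  by rewrite -subset0 => /(_ z); apply.
have sumE n : \sum_(0 <= i < n) m (F i) = m (\bigcup_k F k) - m (tail n).
  elim: n => [|n IH]; first by rewrite big_nil tail0 subrr.
  by rewrite big_nat_recr//= IH tailS; ring.
have area_tail : (fun n => fine (area (S `&` tail n))) @ \oo --> (0 : R).
  suff /fine_cvgP[] : (fun n => area (S `&` tail n)) @ \oo --> 0%:E by [].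
  have -> : 0%:E = area (\bigcap_n (S `&` tail n)).
    rewrite (_ : \bigcap_n _ = set0) ?measure0// -subset0 => z H.
    have [_ [k _ Fk]] := H 0%N I; have [_ [j /= kj Fj]] := H k.+1 I.
    have /trivIsetP/(_ k j I I) := tF; rewrite neq_ltn kj => /(_ isT).
    by rewrite -subset0 => /(_ z); apply.
  apply: (@nonincreasing_cvg_mu _ _ _ area (fun n => S `&` tail n)) => //.
  - apply: le_lt_trans Sfin; apply: le_measure; rewrite ?inE//.
    exact: measurableI.
  - by move=> n; exact: measurableI.
  - by apply: bigcap_measurable => // n _; exact: measurableI.
  - move=> n k nk; apply/subsetPset => z [Sz [j /= kj Fj]]; split => //.
    by exists j => //=; exact: leq_trans kj.
have -> : (fun n => \sum_(0 <= i < n) (`|m (F i)|)%:E)%E =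
    (fun n => (m (\bigcup_k F k) - m (tail n))%:E).
  apply/funext => n; rewrite -sumE sumEFin; congr EFin.
  by apply: eq_bigr => i _; rewrite ger0_norm// m0.
rewrite ger0_norm ?m0//; apply: cvg_EFin; first exact: nearW.
apply/cvgrPdist_le => e e0.
(* Chosen so that [C * t <= e / 2] whatever the sign of [C]; the area term falls below [e / 2] for
   large [n]. *)
pose t := e / (2 * (`|C| + 1)).
have C1 : 0 < `|C| + 1 by rewrite ltr_wpDl.
have t0 : 0 < t by rewrite divr_gt0// mulr_gt0.
have Ct : C * t <= e / 2.
  rewrite /t (_ : e / 2 = (`|C| + 1) * (e / (2 * (`|C| + 1)))).
    by rewrite ler_wpM2r ?(ltW t0)// (le_trans (ler_norm C))// lerDl.
  by field; rewrite gt_eqF.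
have d0 : 0 < t ^+ 2 * (e / 2) by rewrite mulr_gt0 ?exprn_gt0 ?divr_gt0.
have /cvgr0Pnorm_le/(_ _ d0) := area_tail.
apply: filterS => n /= Hn.
rewrite opprB addrC subrK.
rewrite ger0_norm ?m0//; apply: le_trans (mC t _ t0 (mtail n)) _.
have : fine (area (S `&` tail n)) / t ^+ 2 <= e / 2.
  rewrite ler_pdivrMr ?exprn_gt0// mulrC; apply: le_trans Hn; exact: ler_norm.
lra.
Qed.

Section ContentToProbability.
Variables (m : set plane -> R) (S : set plane) (C : R).
Hypotheses (cm : prob_content m) (mS : measurable S) (Sfin : (area S < +oo)%E).
Hypothesis mC : forall t A, 0 < t -> measurable A ->
  m A <= C * t + fine (area (S `&` A)) / t ^+ 2.

(* The absolute value only matters on non-measurable sets. *)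
Definition content_measure A : \bar R := (`|m A|)%:E.

Let content_measure0 : content_measure set0 = 0%E.
Proof.
have [_ _ /(_ set0 set0 measurable0 measurable0)] := cm.
rewrite setU0 setI0 => /(_ erefl) H.
have E : m set0 = 0 by lra.
by rewrite /content_measure E normr0.
Qed.

Let content_measure_ge0 A : (0 <= content_measure A)%E.
Proof. by rewrite lee_fin. Qed.

HB.instance Definition _ := isMeasure.Build _ plane R content_measure
  content_measure0 content_measure_ge0
  (prob_content_sigma_additive cm mS Sfin mC).

Let content_measureT : content_measure setT = 1%E.
Proof. by have [_ E _] := cm; rewrite /content_measure E normr1. Qed.

HB.instance Definition _ := Measure_isProbability.Build _ plane R content_measure
  content_measureT.

Lemma probability_of_content : exists mu : probability plane R,
  forall A, mu A = (`|m A|)%:E.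
Proof. by exists content_measure. Qed.

End ContentToProbability.

(** * Invariant measure from Cesaro means *)

Section PiecewiseAffineAcip.
Variables (b c1 c2 c3 : R) (q : bool -> bool -> bool -> plane) (S : set plane).
Hypotheses (b1 : 1 < b) (mS : measurable S) (Sfin : (area S < +oo)%E).
Hypothesis boxS : box 1 `<=` S.
Local Notation T := (pwmap b c1 c2 c3 q).
Hypothesis TS : forall z, S z -> S (T z).

Let nu k A := unit_square_content (iter k T @^-1` A).

Let avg n A := n.+1%:R^-1 * \sum_(k < n.+1) nu k A.

(** Orbits starting in the unit square stay in [S]. *)
Let nuS k A B : (forall z, S z -> A z <-> B z) -> nu k A = nu k B.
Proof.
move=> AB; congr (fine (area _)).
have iS z : box 1 z -> S (iter k T z).
  by move=> /boxS Sz; elim: k => [//|k IH]; rewrite iterS; exact: TS.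
by apply/seteqP; split=> z [Qz /=]; move/AB: (iS z Qz) => H /H.
Qed.

Let cnu k : prob_content (nu k).
Proof.
apply: prob_content_preimage unit_square_prob_content.
exact: measurable_iter_pwmap.
Qed.

Let n0 n : 0 < n.+1%:R :> R. Proof. by rewrite ltr0n. Qed.

Let cavg n : prob_content (avg n).
Proof.
split=> [A mA||A B mA mB AB].
- rewrite mulr_ge0 ?invr_ge0//.
  by apply: sumr_ge0 => k _; have [H _ _] := cnu k; exact: H.
- rewrite /avg (eq_bigr (fun=> 1)); last by move=> k _; have [_ H _] := cnu k.
  by rewrite sumr_const card_ord mulVf// gt_eqF.
- rewrite /avg -mulrDr -big_split/=; congr (_ * _).
  by apply: eq_bigr => k _; have [_ _ H] := cnu k; exact: H.
Qed.

(** The sum telescopes, so the invariance defect is of order [1 / n]. *)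
Let avg_shift n A : avg n (T @^-1` A) - avg n A = (nu n.+1 A - nu 0 A) / n.+1%:R.
Proof.
rewrite /avg -mulrBr mulrC; congr (_ / _).
have -> : \sum_(k < n.+1) nu k (T @^-1` A) = \sum_(k < n.+1) nu k.+1 A by [].
rewrite -(big_mkord xpredT (fun k => nu k.+1 A)) -(big_mkord xpredT (nu^~ A)).
by rewrite -sumrB telescope_sumr.
Qed.

(** [area_bound] divided by [t ^+ 2], for each iterate and hence for the means. Replacing [A] by its
    trace on [S] makes the area finite. *)
Let uniform_bound : exists C, forall n t A, 0 < t -> measurable A ->
  avg n A <= C * t + fine (area (S `&` A)) / t ^+ 2.
Proof.
have f1 l : l \in forms -> lin l (1, 0) = 0 \/ lin l (1, 0) = 1 :> R.
  by rewrite !inE => /or3P[] /eqP->; rewrite /lin/=; [right|left|right]; ring.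
have f2 l : l \in forms -> lin l (0, 1) = 0 \/ lin l (0, 1) = 1 :> R.
  by rewrite !inE => /or3P[] /eqP->; rewrite /lin/=; [left|right|right]; ring.
have [C1 C10 V1] := iter_pwmap_variation c1 c2 c3 q b1 f1 unit_square_prob_content
  unit_square_variation1.
have [C2 C20 V2] := iter_pwmap_variation c1 c2 c3 q b1 f2 unit_square_prob_content
  unit_square_variation2.
pose C := C1 + C2.
exists (2 * C) => n t A t0 mA.
have step k : nu k A <= 2 * C * t + fine (area (S `&` A)) / t ^+ 2.
  have mSA : measurable (S `&` A) by exact: measurableI.
  have -> : nu k A = nu k (S `&` A).
    by apply: nuS => z Sz; split=> [|[]].
  have C1C : C1 <= C by rewrite lerDl.
  have C2C : C2 <= C by rewrite lerDr.
  have := @area_bound R (iter k T) C t (S `&` A) (measurable_iter_pwmap _ _ _ _ _ _)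
    (addr_ge0 C10 C20) 
    (variation_leW C1C (V1 k)) (variation_leW C2C (V2 k)) t0 mSA.
  rewrite -[area _]fineK; last first.
    rewrite ge0_fin_numE//; apply: le_lt_trans Sfin; apply: le_measure;
      by rewrite ?inE.
  rewrite lee_fin -/(nu k (S `&` A)) => H.
  rewrite -lerBlDl ler_pdivlMr ?exprn_gt0// mulrC; exact: H.
rewrite /avg mulrC ler_pdivrMr//.
apply: (@le_trans _ _ (\sum_(k < n.+1) (2 * C * t + fine (area (S `&` A)) / t ^+ 2))).
  by apply: ler_sum => k _; exact: step.
by rewrite sumr_const card_ord mulr_natr.
Qed.

Lemma pwmap_acip (f : plane -> plane) : (forall z, S z -> f z = T z) ->
  exists mu : probability plane R, acip S f mu.
Proof.
move=> fT.
have [C HC] := uniform_bound.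
(* An ultrafilter finer than [\oo] makes the means converge on all measurable sets at once and keeps
   the limits that exist along [\oo]. *)
have [U [UU oU]] := @ultraFilterLemma nat \oo _.
pose m A := lim ((fun n => avg n A) @ U).
have cvgm A : measurable A -> (fun n => avg n A) @ U --> m A.
  move=> mA; apply: (@bounded_ultra_cvg _ U _ 0 1) => n.
  by rewrite (prob_content_le1 (cavg n) mA) andbT; have [H _ _] := cavg n; exact: H.
have mE A l : (fun n => avg n A) @ U --> l -> m A = l by move=> /cvg_lim; exact.
have cm : prob_content m.
  split=> [A mA||A B mA mB AB].
  - apply: (cvgr_to_ge (cvgm A mA)); apply: nearW => n.
    by have [H _ _] := cavg n; exact: H.
  - apply: mE; rewrite (_ : (fun n => _) = (fun=> 1)); first exact: cvg_cst.
    by apply/funext => n; have [_ H _] := cavg n.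
  - apply: mE; rewrite (_ : (fun n => _) = (fun n => avg n A + avg n B)).
      exact: cvgD (cvgm A mA) (cvgm B mB).
    by apply/funext => n; have [_ _ H] := cavg n; exact: H.
have mb t A : 0 < t -> measurable A -> m A <= C * t + fine (area (S `&` A)) / t ^+ 2.
  move=> t0 mA; apply: (cvgr_to_le (cvgm A mA)); apply: nearW => n; exact: HC.
have [mu muE] := probability_of_content cm mS Sfin mb.
exists mu; split.
- rewrite muE (_ : m S = 1) ?normr1//.
  have [_ <- _] := cm; rewrite /m; congr (lim (_ @ U)); apply/funext => n.
  by rewrite /avg; congr (_ * _); apply: eq_bigr => k _; exact: nuS.
- move=> A mA; rewrite !muE; congr ((`|_|)%:E).
  apply: mE.
  rewrite (_ : (fun n => _) = (fun n => avg n A + (nu n.+1 A - nu 0 A) / n.+1%:R)).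
    rewrite -[m A]addr0; apply: cvgD; first exact: cvgm.
    suff H : (fun n => (nu n.+1 A - nu 0 A) / n.+1%:R) @ \oo --> (0 : R).
      by move=> B B0; apply: oU; exact: (H B B0).
    apply/cvgr0Pnorm_le => e e0.
    have /cvgr0Pnorm_le/(_ e e0) := @cvg_harmonic R.
    apply: filterS => n /= Hn; apply: le_trans Hn.
    rewrite /harmonic normrM ler_piMl//.
    have nu01 k : 0 <= nu k A <= 1.
      by rewrite (prob_content_le1 (cnu k) mA) andbT; have [H _ _] := cnu k; exact: H.
    have /andP[h1 h2] := nu01 n.+1; have /andP[h3 h4] := nu01 0%N.
    by rewrite ler_norml; apply/andP; split; lra.
  apply/funext => n; rewrite -avg_shift addrC subrK.
  rewrite /avg; congr (_ * _); apply: eq_bigr => k _.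
  by apply: nuS => z Sz; rewrite /preimage/= fT.
- apply/null_content_dominatesP => A mA A0.
  have SA0 : fine (area (S `&` A)) = 0.
    suff -> : area (S `&` A) = 0%E by [].
    apply/eqP; rewrite -measure_le0 -[X in (_ <= X)%E]A0.
    by apply: le_measure; rewrite ?inE//; exact: measurableI.
  rewrite muE (_ : m A = 0) ?normr0//; apply/eqP; rewrite eq_le; apply/andP; split.
    (* On a null set the bound reads [m A <= C * t] for every [t > 0]. *)
    apply/ler_addgt0Pl => e e0; rewrite addr0.
    have t0 : 0 < e / (`|C| + 1) by rewrite divr_gt0// ltr_wpDl.
    have := mb _ A t0 mA; rewrite SA0 mul0r addr0 => H; apply: le_trans H _.
    rewrite mulrCA -[leRHS]mulr1 ler_pM2l// ler_pdivrMr ?ltr_wpDl// mul1r.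
    by rewrite (le_trans (ler_norm C))// lerDl.
  by have [H _ _] := cm; exact: H.
Qed.

End PiecewiseAffineAcip.
End Limit.

(** * The greedy and lazy maps as instances *)

Section GreedyLazy.
Variables (R : realType) (b : R).
Hypotheses (b1 : 1 < b) (b32 : b <= 3 / 2).
Local Notation plane := (R * R)%type.
Implicit Types z : plane.

Let b0 : 0 < b. Proof. exact: lt_trans b1. Qed.

Let bB1 : 0 < b - 1. Proof. by rewrite subr_gt0. Qed.

Let bthr2 : b * thr2 b = thr2 b + 1.
Proof. by rewrite /thr2; field; rewrite gt_eqF. Qed.

Let bthr1 : b * thr1 b = thr2 b.
Proof. by rewrite /thr1 /thr2; field; rewrite !gt_eqF. Qed.

(** This is where [b <= 3 / 2] enters; it puts the unit square inside the triangle. *)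
Let thr2_ge2 : 2 <= thr2 b.
Proof. by rewrite /thr2 ler_pdivlMr//; move: b32 => h; lra. Qed.

(** Multiplied by [b], this is [thr2_ge2]. Hence a point with [x + y > thr1 b] has a coordinate
    above [1 / b]. *)
Let invb_thr1 : 1 / b + 1 / b <= thr1 b.
Proof.
have bv : b * (1 / b) = 1 by rewrite mulrC divfK// gt_eqF.
rewrite -(ler_pM2l b0) bthr1 mulrDr !bv; exact: thr2_ge2.
Qed.

Let invb_le (x : R) : 1 / b <= x -> 1 <= b * x.
Proof. by rewrite ler_pdivrMr// mulrC. Qed.

Let measurable_Sb : measurable (Sb b).
Proof.
have mb : measurable_fun setT (fun z : plane =>
    (0 <= z.1) && (0 <= z.2) && (z.1 + z.2 <= thr2 b)).
  apply: measurable_and.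
    by apply: measurable_and; apply: measurable_fun_ler.
  by apply: measurable_fun_ler => //; exact: measurable_funD.
have := mb measurableT [set true] I; rewrite setTI.
by congr measurable; apply/seteqP; split.
Qed.

Let area_Sb : (area (Sb b) < +oo)%E.
Proof.
apply: (@le_lt_trans _ _ (area (box (thr2 b)))); last first.
  by rewrite area_box ?ltry//; exact: le_trans thr2_ge2.
apply: le_measure; rewrite ?inE//; first exact: measurable_box.
move=> [x y]; rewrite /Sb /box/= !in_itv/= => /andP[/andP[x0 y0] xy].
by rewrite x0 y0/=; split; lra.
Qed.

Let box_Sb : box 1 `<=` Sb b.
Proof.
move=> [x y]; rewrite /Sb /box/= !in_itv/= => -[/andP[x0 x1] /andP[y0 y1]].
by rewrite x0 y0/= (le_trans _ thr2_ge2)//; lra.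
Qed.

(** On the triangle, [b z - q_i] stays inside exactly when [x + y <= thr1 b], [x >= 1 / b],
    [y >= 1 / b] for [i = 0, 1, 2] respectively. The greedy choice is the largest such [i]. *)
Definition greedy_digit (dx dy ds : bool) : plane :=
  if dy then if dx then (0, 0) else (1, 0) else (0, 1).

(** The smallest admissible index. *)
Definition lazy_digit (dx dy ds : bool) : plane :=
  if ds then (0, 0) else if dx then (0, 1) else (1, 0).

Local Notation Tgreedy := (pwmap b (1 / b) (1 / b) (thr1 b) greedy_digit).
Local Notation Tlazy := (pwmap b (1 / b) (1 / b) (thr1 b) lazy_digit).

Let greedyE z : Sb b z -> greedy b z = Tgreedy z.
Proof.
case: z => x y; rewrite /Sb/= => /andP[/andP[x0 y0] xy].
have [vt t1 t2] : [/\ 1 / b + 1 / b <= thr1 b, b * thr1 b = thr2 b &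
  b * thr2 b = thr2 b + 1] by [].
rewrite /greedy /pwmap /digit /greedy_digit /inE0 /inC01 /inE1 /inC012 /inC12.
rewrite /inC02 /inE2 /shift0 /shift1 /shift2 /= x0 y0 xy/=.
case: (ltP x (1 / b)) => hx; case: (ltP y (1 / b)) => hy;
  case: (leP (x + y) (thr1 b)) => hs //=; rewrite ?subr0//.
Qed.

Let lazyE z : Sb b z -> lazy b z = Tlazy z.
Proof.
case: z => x y; rewrite /Sb/= => /andP[/andP[x0 y0] xy].
have [vt t1 t2] : [/\ 1 / b + 1 / b <= thr1 b, b * thr1 b = thr2 b &
  b * thr2 b = thr2 b + 1] by [].
rewrite /lazy /pwmap /digit /lazy_digit /inE0 /inC01 /inE1 /inC012 /inC12.
rewrite /inC02 /inE2 /shift0 /shift1 /shift2 /= x0 y0 xy/=.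
case: (ltP x (1 / b)) => hx; case: (ltP y (1 / b)) => hy;
  case: (leP (x + y) (thr1 b)) => hs //=; rewrite ?subr0//.
(* The remaining pattern has both coordinates below [1 / b] and sum above [thr1 b], which [vt]
   excludes. *)
by exfalso; lra.
Qed.

(** A nonzero digit is taken from a coordinate at least [1 / b] and brings the sum down to at most
    [b * thr2 b - 1 = thr2 b]. With digit zero the sum is below [2 / b <= thr1 b], which [b] maps to
    [thr2 b]. *)
Let greedy_Sb z : Sb b z -> Sb b (Tgreedy z).
Proof.
case: z => x y; rewrite /Sb/= => /andP[/andP[x0 y0] xy].
have [vt t1 t2] : [/\ 1 / b + 1 / b <= thr1 b, b * thr1 b = thr2 b &
  b * thr2 b = thr2 b + 1] by [].
have bx := mulr_ge0 (ltW b0) x0; have by_ := mulr_ge0 (ltW b0) y0.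
have bxy : b * (x + y) <= b * thr2 b by rewrite ler_pM2l.
rewrite /digit /greedy_digit /=.
case: (ltP y (1 / b)) => hy /=.
  case: (ltP x (1 / b)) => hx /=.
    have : b * (x + y) <= b * thr1 b by rewrite ler_pM2l//; lra.
    by move=> h; rewrite !subr0 bx by_/=; lra.
  by have h := invb_le hx; apply/andP; split; [apply/andP; split|]; lra.
by have h := invb_le hy; apply/andP; split; [apply/andP; split|]; lra.
Qed.

Let lazy_Sb z : Sb b z -> Sb b (Tlazy z).
Proof.
case: z => x y; rewrite /Sb/= => /andP[/andP[x0 y0] xy].
have [vt t1 t2] : [/\ 1 / b + 1 / b <= thr1 b, b * thr1 b = thr2 b &
  b * thr2 b = thr2 b + 1] by [].
have bx := mulr_ge0 (ltW b0) x0; have by_ := mulr_ge0 (ltW b0) y0.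
have bxy : b * (x + y) <= b * thr2 b by rewrite ler_pM2l.
rewrite /digit /lazy_digit /=.
case: (leP (x + y) (thr1 b)) => hs /=.
  have : b * (x + y) <= b * thr1 b by rewrite ler_pM2l.
  by move=> h; rewrite !subr0 bx by_/=; lra.
case: (ltP x (1 / b)) => hx /=.
  (* By [vt], beyond the line [x + y = thr1 b] a small [x] forces a large [y]. *)
  have hy : 1 / b <= y by lra.
  by have h := invb_le hy; apply/andP; split; [apply/andP; split|]; lra.
by have h := invb_le hx; apply/andP; split; [apply/andP; split|]; lra.
Qed.

Lemma greedy_acip : exists mu : probability plane R, acip (Sb b) (greedy b) mu.
Proof. exact: (pwmap_acip b1 measurable_Sb area_Sb box_Sb greedy_Sb greedyE). Qed.

Lemma lazy_acip : exists mu : probability plane R, acip (Sb b) (lazy b) mu.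
Proof. exact: (pwmap_acip b1 measurable_Sb area_Sb box_Sb lazy_Sb lazyE). Qed.

End GreedyLazy.

Unset Implicit Arguments.
Local Open Scope ring_scope.

Theorem theorem3p4 (R : realType) (b : R) (hb1 : 1 < b) (hb2 : b <= 3 / 2) :
  (exists mu : probability (R * R)%type R, acip (Sb b) (greedy b) mu) /\
  (exists mu : probability (R * R)%type R, acip (Sb b) (lazy b) mu).
Proof. by split; [exact: greedy_acip|exact: lazy_acip]. Qed.
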